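(* There exists an infinite set $\mathfrak R$ of simple graphs such that $\Pi_{\mathfrak R,1}\neq\Pi_{\mathfrak G,1}$ for every finite set $\mathfrak G$ of hypergraphs. Here two clustering schemes are equal if they assign the same set of parts to every hypergraph. In particular, there is a representable endofunctor $\Phi_{\mathfrak R}$ which is not equal to $\Phi_{\mathfrak G}$ for any finite set $\mathfrak G$ of hypergraphs.
   Context: A hypergraph is a triple $G=(V,E,\epsilon)$, where $V$ is a finite vertex set, $E$ is a finite edge set disjoint from $V$, and $\epsilon:E\to 2^V$ gives each edge's vertex set. Distinct edges may have the same vertex set. A morphism $H\to G$ is an injective map $f:V(H)\to V(G)$ such that for every edge $e$ of $H$ there is an edge $e'$ of $G$ with $f(\epsilon_H(e))=\epsilon_G(e')$; $\hom(H,G)$ is the set of such morphisms. A simple graph is a hypergraph all of whose edges have exactly two vertices, with no two edges having the same vertex set. For a set $\mathfrak R$ of hypergraphs, $\Phi_{\mathfrak R}(G)$ has vertex set $V(G)$ and edge set $\bigcup_{R\in\mathfrak R}\hom(R,G)$ (disjoint union), where the edge $\omega\in\hom(R,G)$ has vertex set $\omega(V(R))$. For $k\in\mathbb N\cup\{\infty\}$, the $k$-line graph $\Lambda_k(G)$ is the simple graph with vertex set $\{\epsilon(e):e\in E\}$ in which distinct $u,v$ are adjacent iff $|u\cap v|\ge k$. $\Pi_k(G)$ is the pair $(V(G),P)$ where $P$ is the set of all $\bigcup_{x\in C}x$, with $C$ ranging over the vertex sets of connected components (including singletons) of $\Lambda_k(G)$. Finally, $\Pi_{\mathfrak R,k}:=\Pi_k\circ\Phi_{\mathfrak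 R}$. *)

(* Defs.v *)
From mathcomp Require Import all_boot.
From mathcomp Require Import boolp classical_sets functions cardinality.

Set Implicit Arguments.
Unset Strict Implicit.
Unset Printing Implicit Defensive.

(* The edges form an arbitrary type that is finite in the propositional sense,
   so that the dependent sums used in [Phi_obj] below can serve as edge types.
   Vertices and edges live in different types, hence are disjoint. *)
Record hypergraph := Hypergraph {
  vert : finType;
  edge : Type;
  edge_finite : finite_set [set: edge]%classic;
  eps : edge -> {set vert}
}.

Definition is_hom (H G : hypergraph) (f : {ffun vert H -> vert G}) : Prop :=
  injective f /\
  forall e : edge H, exists e' : edge G, f @: eps e = eps e'.

Definition hom (H G : hypergraph) :=
  {f : {ffun vert H -> vert G} | `[< is_hom f >]}.

Definition Hom (H G : hypergraph) (f : {ffun vert H -> vert G}) (h : is_hom f) :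
  hom H G := exist (fun f => `[< is_hom f >]) f (asboolT h).

Lemma hom_id_subproof (G : hypergraph) :
  @is_hom G G [ffun x => x].
Proof.
split=> [x y|e]; first by rewrite !ffunE.
exists e; rewrite -[RHS]imset_id; apply: eq_imset => x.
by rewrite ffunE.
Qed.

Definition hom_id (G : hypergraph) : hom G G := Hom (hom_id_subproof G).

Lemma hom_comp_subproof (G1 G2 G3 : hypergraph) (g : hom G2 G3) (f : hom G1 G2) :
  is_hom [ffun x => val g (val f x)].
Proof.
case: g f => [g /= /asboolP[gi gE]] [f /= /asboolP[fi fE]].
split=> [x y|e]; first by rewrite !ffunE => /gi /fi.
have [e1 Ee1] := fE e; have [e2 Ee2] := gE e1; exists e2.
rewrite -Ee2 -Ee1 -imset_comp; apply: eq_imset => x.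
by rewrite ffunE.
Qed.

Definition hom_comp (G1 G2 G3 : hypergraph) (g : hom G2 G3) (f : hom G1 G2) :
  hom G1 G3 := Hom (hom_comp_subproof g f).

Definition simple_graph (G : hypergraph) : Prop :=
  (forall e : edge G, #|eps e| = 2) /\ injective (@eps G).

Record endofunctor := Endofunctor {
  fobj : hypergraph -> hypergraph;
  fmor : forall G1 G2 : hypergraph, hom G1 G2 -> hom (fobj G1) (fobj G2);
  fmor_id : forall G : hypergraph, fmor (hom_id G) = hom_id (fobj G);
  fmor_comp : forall (G1 G2 G3 : hypergraph) (g : hom G2 G3) (f : hom G1 G2),
    fmor (hom_comp g f) = hom_comp (fmor g) (fmor f)
}.

Definition nat_iso (F F' : endofunctor) : Prop :=
  exists (eta : forall G, hom (fobj F G) (fobj F' G))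
         (theta : forall G, hom (fobj F' G) (fobj F G)),
    (forall G, hom_comp (theta G) (eta G) = hom_id (fobj F G)) /\
    (forall G, hom_comp (eta G) (theta G) = hom_id (fobj F' G)) /\
    (forall G1 G2 (f : hom G1 G2),
       hom_comp (eta G2) (fmor F f) = hom_comp (fmor F' f) (eta G1)).

Definition locally_finite (I : Type) (R : I -> hypergraph) : Prop :=
  forall G : hypergraph, finite_set [set: {i : I & hom (R i) G}]%classic.

(* A set of hypergraphs, given by an injective enumeration along an index type
   of arbitrary size: a predicate on [hypergraph] would put the edges of
   [Phi_obj] in too large a universe.  Local finiteness says precisely that
   Phi_R(G) has finitely many edges for every G, i.e. that Phi_R is defined as
   an endofunctor; by [finite_locally_finite] it holds for every finite set. *)
Record hgset := HgSet {
  idx : Type;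
  elt : idx -> hypergraph;
  elt_inj : injective elt;
  elt_locally_finite : locally_finite elt
}.

Lemma finite_locally_finite (I : Type) (R : I -> hypergraph) :
  finite_set [set: I]%classic -> locally_finite R.
Proof.
move=> finI G.
have -> : [set: {i : I & hom (R i) G}]%classic =
    (\bigcup_(i in [set: I]) range (@existT I (fun i => hom (R i) G) i))%classic.
  by rewrite predeqE => -[i f]; split=> // _; exists i => //; exists f.
by apply: bigcup_finite => // i _; apply: finite_image; apply: finite_finset.
Qed.

Definition finite_hgset (R : hgset) : Prop := finite_set [set: idx R]%classic.

Definition Phi_obj (R : hgset) (G : hypergraph) : hypergraph :=
  @Hypergraph (vert G) {i : idx R & hom (elt i) G}
    (@elt_locally_finite R G)
    (fun w => val (projT2 w) @: [set: vert (elt (projT1 w))]).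

Lemma Phi_mor_subproof (R : hgset) (G1 G2 : hypergraph) (f : hom G1 G2) :
  @is_hom (Phi_obj R G1) (Phi_obj R G2) (val f).
Proof.
have /asboolP[fi _] := valP f; split=> // -[i w].
exists (existT _ i (hom_comp f w)) => /=.
by rewrite -imset_comp; apply: eq_imset => x; rewrite ffunE.
Qed.

Definition Phi_mor (R : hgset) (G1 G2 : hypergraph) (f : hom G1 G2) :
  hom (Phi_obj R G1) (Phi_obj R G2) := Hom (Phi_mor_subproof R f).

Lemma Phi_mor_id (R : hgset) (G : hypergraph) :
  Phi_mor R (hom_id G) = hom_id (Phi_obj R G).
Proof. exact: val_inj. Qed.

Lemma Phi_mor_comp (R : hgset) (G1 G2 G3 : hypergraph)
    (g : hom G2 G3) (f : hom G1 G2) :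
  Phi_mor R (hom_comp g f) = hom_comp (Phi_mor R g) (Phi_mor R f).
Proof. exact: val_inj. Qed.

Definition Phi (R : hgset) : endofunctor :=
  Endofunctor (Phi_mor_id R) (@Phi_mor_comp R).

(* N together with infinity, the latter encoded as [None]. *)
Definition le_card (k : option nat) (n : nat) : bool :=
  if k is Some m then m <= n else false.

Definition edge_sets (G : hypergraph) : {set {set vert G}} :=
  [set u : {set vert G} | `[< exists e : edge G, eps e = u >]].

Definition line_vert (G : hypergraph) : finType :=
  {u : {set vert G} | u \in edge_sets G}.

(* The adjacency relation of Lambda_k(G), on its vertex type. *)
Definition line_graph (k : option nat) (G : hypergraph) : rel (line_vert G) :=
  fun u v => (u != v) && le_card k #|val u :&: val v|.

(* A clustering scheme returns (V(G), P); only P is recorded, since V(G) is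
   carried by the type. *)
Definition clustering_scheme := forall G : hypergraph, {set {set vert G}}.

(* [connect] is the reflexive transitive closure, so the union is taken over the
   connected component of u in Lambda_k(G). *)
Definition Pi (k : option nat) : clustering_scheme := fun G =>
  [set \bigcup_(v | connect (@line_graph k G) u v) val v | u : line_vert G].

Definition Pi_hg (R : hgset) (k : option nat) : clustering_scheme :=
  fun G => Pi k (fobj (Phi R) G).

Definition eq_scheme (P Q : clustering_scheme) : Prop :=
  forall G : hypergraph, P G = Q G.

(* Main.v *)
Require Import Defs.
From mathcomp Require Import boolp classical_sets cardinality.
From mathcomp Require Import all_boot zify.

Set Implicit Arguments.
Unset Strict Implicit.
Unset Printing Implicit Defensive.

(** Take for [R] the set of all cycles.  Whether [Phi_R(G)] has an edge at all
    is read off from [Pi_{R,1}(G)], and is invariant under natural isomorphism.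
    If [S] is finite and [m] exceeds the size of all its members, a morphism
    from a member of [S] to the cycle [C_m] misses some vertex [v], hence is
    also a morphism to the graph obtained from [C_m] by deleting the edges at
    [v].  No cycle maps to that graph, since the image of a cycle in [C_m] is
    closed under the cyclic successor. *)

(** The offset keeps the length at least 3, so that no edge degenerates and no two edges
    coincide. *)
Definition cycle_graph (n : nat) : hypergraph :=
  @Hypergraph 'I_n.+3 'I_n.+3 finite_finset (fun i => [set i; ordS i]).

(** The vertex [v] stays, isolated, so that a map into the cycle can be reused unchanged. *)
Definition punctured_cycle (n : nat) (v : 'I_n.+3) : hypergraph :=
  @Hypergraph 'I_n.+3 {i : 'I_n.+3 | v \notin [set i; ordS i]}
    finite_finset (fun i => [set val i; ordS (val i)]).

Lemma ordS_neq n (i : 'I_n.+3) : ordS i != i.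
Proof.
rewrite -val_eqE /=; case: i => i /=; rewrite ltnS leq_eqVlt => /orP[/eqP->|lti].
  by rewrite modnn.
by rewrite modn_small ?ltnS //; lia.
Qed.

Lemma ordSS_neq n (i : 'I_n.+3) : ordS (ordS i) != i.
Proof.
apply/negP => /eqP/(congr1 val) /=; rewrite -addn1 modnDml addn1.
case: i => i /= lti; have [ge|lt] := leqP n.+3 i.+2.
  by rewrite -(subnK ge) modnDr modn_small; lia.
by rewrite modn_small; lia.
Qed.

Lemma set2_eq (T : finType) (a b c d : T) :
  [set a; b] = [set c; d] -> (a = c /\ b = d) \/ (a = d /\ b = c).
Proof.
move=> E.
have : a \in [set c; d] by rewrite -E set21.
have : b \in [set c; d] by rewrite -E set22.
have : c \in [set a; b] by rewrite E set21.
have : d \in [set a; b] by rewrite E set22.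
rewrite !in_set2.
by do 4 (case/orP => /eqP ?; subst); auto.
Qed.

Lemma cycle_graph_simple n : simple_graph (cycle_graph n).
Proof.
split=> [i|i j] /=; first by rewrite cards2 eq_sym ordS_neq.
move=> /set2_eq [[//]|[-> /eqP]].
by rewrite (negPf (ordSS_neq _)).
Qed.

Lemma cycle_graph_inj : injective cycle_graph.
Proof.
by move=> m n /(congr1 (fun G => #|vert G|)); rewrite !card_ord => -[].
Qed.

Lemma hom_card (H G : hypergraph) : hom H G -> #|vert H| <= #|vert G|.
Proof. by move=> [f /= /asboolP[/leq_card]]. Qed.

(** Morphisms are injective, so only cycles with at most [#|vert G|] vertices map to [G]. *)
Lemma cycle_graph_locally_finite : locally_finite cycle_graph.
Proof.
move=> G.
have -> : [set: {n : nat & hom (cycle_graph n) G}]%classic =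
    (\bigcup_(n in `I_(#|vert G|))
       range (@existT nat (fun n => hom (cycle_graph n) G) n))%classic.
  rewrite predeqE => -[n f]; split=> // _; exists n; last by exists f.
  by have := hom_card f; rewrite /= card_ord; lia.
apply: bigcup_finite => [|n _]; first exact: finite_II.
by apply: finite_image; apply: finite_finset.
Qed.

Definition cycles : hgset := HgSet cycle_graph_inj cycle_graph_locally_finite.

Lemma ordS_closed_setT n (A : {set 'I_n.+1}) (x y : 'I_n.+1) :
  {in A, forall z, ordS z \in A} -> x \in A -> y \in A.
Proof.
move=> Acl xA.
have iterA k : iter k (@ordS n.+1) x \in A by elim: k => //= k; apply: Acl.
have iterE k : val (iter k (@ordS n.+1) x) = (x + k) %% n.+1.
  elim: k => [|k IH]; first by rewrite addn0 modn_small.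
  by rewrite iterS /= IH -addn1 modnDml addn1 addnS.
(* The first [n.+1 - x] steps wrap around to 0; [y] more steps reach [y]. *)
have <- // : iter (n.+1 - x + y) (@ordS n.+1) x = y.
apply: val_inj; rewrite iterE addnA subnKC; last exact: (ltnW (ltn_ord x)).
by rewrite modnDl modn_small.
Qed.

(** The two edges at [i] go to edges at [f i]. These are different, as [f] is injective and the two
    neighbours of [i] are distinct, so one of them leads to the successor of [f i]. *)
Lemma cycle_image_ordS_closed n m (f : 'I_n.+3 -> 'I_m.+3) :
  injective f ->
  (forall i, exists j, [set f i; f (ordS i)] = [set j; ordS j]) ->
  {in f @: setT, forall x, ordS x \in f @: setT}.
Proof.
move=> finj fE _ /imsetP[i _ ->].
have [j /set2_eq[[-> <-]|[fi fSi]]] := fE i; first exact: imset_f.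
have [j'] := fE (ord_pred i); rewrite ord_predK.
case/set2_eq=> [[fpi fi']|[fpi ->]]; last by rewrite -fpi imset_f.
have jj' : j = j' by apply: (can_inj (@ordSK _)); rewrite -fi -fi'.
have /finj pS : f (ordS i) = f (ord_pred i) by rewrite fSi fpi.
by have := ordSS_neq i; rewrite pS ord_predK eqxx.
Qed.

(** The image, nonempty and closed under successor, contains [v]; but then an edge of the source
    cycle would go to an edge at [v]. *)
Lemma no_hom_cycle_punctured n m (v : 'I_m.+3) :
  hom (cycle_graph n) (punctured_cycle v) -> False.
Proof.
move=> [f /= /asboolP[finj fE]].
have fE2 i : exists2 j, v \notin [set j; ordS j]
    & [set f i; f (ordS i)] = [set j; ordS j].
  by have [[j vj] /=] := fE i; rewrite imsetU1 imset_set1; exists j.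
have fcl : {in f @: setT, forall x, ordS x \in f @: setT}.
  by apply: cycle_image_ordS_closed => // i; have [j _ ->] := fE2 i; exists j.
have /imsetP[i _ vfi] : v \in f @: setT.
  by apply: (ordS_closed_setT (x := f ord0)) => //; apply: imset_f.
by have [j] := fE2 i; rewrite vfi => /negP vj E; apply: vj; rewrite -E set21.
Qed.

Lemma hom_cycle_puncture (H : hypergraph) n :
  #|vert H| < n.+3 -> hom H (cycle_graph n) ->
  exists v : 'I_n.+3, inhabited (hom H (punctured_cycle v)).
Proof.
move=> ltHn [f /= /asboolP[finj fE]].
have /existsP[v vf] : [exists v, v \notin f @: setT].
  rewrite -negb_forall; apply/negP => /forallP fT.
  have : #|[set: 'I_n.+3]| <= #|f @: setT| by apply/subset_leq_card/subsetP.
  by rewrite card_imset // !cardsT card_ord leqNgt ltHn.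
exists v; split; apply: (@Hom H (punctured_cycle v) f); split=> // e.
have [j /= fej] := fE e.
(* The image of an edge lies in the image of [f], which misses [v]. *)
have vj : v \notin [set j; ordS j].
  apply: contra vf; rewrite -fej; apply/subsetP/imsetS.
  exact: subsetT.
by exists (exist _ j vj).
Qed.

Definition has_hom_to (R : hgset) (G : hypergraph) : Prop :=
  exists i : idx R, inhabited (hom (elt i) G).

Lemma has_hom_to_edge (R : hgset) (G : hypergraph) :
  has_hom_to R G <-> inhabited (edge (Phi_obj R G)).
Proof. by split=> [[i [f]]|[[i f]]]; [split; exists i | exists i]. Qed.

(** Each edge lies in some component and so yields a part; conversely a part comes from a component,
    which contains an edge set. *)
Lemma has_hom_to_Pi (R : hgset) (k : option nat) (G : hypergraph) :
  has_hom_to R G <-> Pi_hg R k G != set0.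
Proof.
rewrite has_hom_to_edge; split=> [[e]|/set0Pn[_ /imsetP[[u uE] _ _]]].
  have eE : eps e \in edge_sets (Phi_obj R G).
    by rewrite inE; apply/asboolP; exists e.
  pose u : line_vert (Phi_obj R G) := Sub (eps e) eE.
  by apply/set0Pn; eexists; apply: (imset_f _ (x := u)).
by move: uE; rewrite inE => /asboolP[e _]; split.
Qed.

Lemma hom_edge (H G : hypergraph) :
  hom H G -> inhabited (edge H) -> inhabited (edge G).
Proof. by move=> [f /asboolP[_ fE]] [e]; have [e' _] := fE e. Qed.

Lemma finite_hgset_card_bound (S : hgset) :
  finite_hgset S -> exists m, forall i : idx S, #|vert (elt i)| <= m.
Proof.
move=> finS.
have /finite_seqP[s sE] : finite_set (range (fun i : idx S => #|vert (elt i)|)).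
  exact: finite_image.
exists (\max_(x <- s) x) => i.
have si : #|vert (elt i)| \in s.
  suff : [set` s]%classic #|vert (elt i)| by [].
  by rewrite -sE; exists i.
exact: leq_bigmax_seq.
Qed.

Lemma cycles_has_hom_to_neq_finite (S : hgset) :
  finite_hgset S ->
  ~ (forall G, has_hom_to cycles G <-> has_hom_to S G).
Proof.
move=> /finite_hgset_card_bound[m mS] eqRS.
have /eqRS[i [f]] : has_hom_to cycles (cycle_graph m).
  by exists m; split; exact: hom_id.
(* [cycle_graph m] has [m.+3] vertices, more than any member of [S]. *)
have [|v [g]] := hom_cycle_puncture _ f; first by have := mS i; lia.
have /eqRS[n [h]] : has_hom_to S (punctured_cycle v) by exists i; split.
exact: no_hom_cycle_punctured h.
Qed.

Lemma nat_iso_has_hom_to (R S : hgset) :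
  nat_iso (Phi R) (Phi S) ->
  forall G, has_hom_to R G <-> has_hom_to S G.
Proof.
move=> [eta [theta _]] G; rewrite !has_hom_to_edge.
by split; [apply: (hom_edge (eta G)) | apply: (hom_edge (theta G))].
Qed.

Lemma nat_iso_refl (F : endofunctor) : nat_iso F F.
Proof.
exists (fun G => hom_id (fobj F G)), (fun G => hom_id (fobj F G)).
by split; [|split] => *; apply: val_inj; apply/ffunP => x; rewrite !ffunE.
Qed.

(* The edges of Phi_R(G) are labelled by the members of R, so [Phi R <> Phi S]
   alone could hold merely because of the labels; the second part excludes
   even a natural isomorphism. *)
Theorem mainTheorem4 :
  exists R : hgset,
    ~ finite_hgset R /\
    (forall i : idx R, simple_graph (elt i)) /\
    (forall S : hgset, finite_hgset S ->
       ~ eq_scheme (Pi_hg R (Some 1)) (Pi_hg S (Some 1))) /\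
    (forall S : hgset, finite_hgset S ->
       Phi R <> Phi S /\ ~ nat_iso (Phi R) (Phi S)).
Proof.
exists cycles; split; first exact: infinite_nat.
split; first exact: cycle_graph_simple.
split=> S finS.
  move=> eqP; apply: (cycles_has_hom_to_neq_finite finS) => G.
  by rewrite !(has_hom_to_Pi _ (Some 1)) eqP.
have niso : ~ nat_iso (Phi cycles) (Phi S).
  by move=> /nat_iso_has_hom_to; apply: cycles_has_hom_to_neq_finite.
by split=> // eqPhi; apply: niso; rewrite eqPhi; apply: nat_iso_refl.
Qed.
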